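(* Let $H$ be a Hopf algebra over $\mathbb{C}$. Then $H$ is inner linear if and only if the Hopf dual $H^0$ contains a finitely generated Hopf subalgebra that separates the points of $H$.
   Context: All Hopf algebras are over $\mathbb{C}$. A Hopf ideal of a Hopf algebra $H$ (with comultiplication $\Delta$, counit $\varepsilon$, antipode $S$) is a two-sided ideal $I$ with $\Delta(I)\subset I\otimes H+H\otimes I$, $\varepsilon(I)=0$, $S(I)\subset I$. $H$ is called inner linear if it contains a (two-sided) ideal of finite codimension that does not contain any non-zero Hopf ideal of $H$. The Hopf dual $H^0$ is the Hopf algebra of linear functionals on $H$ vanishing on a two-sided ideal of finite codimension. ''Finitely generated'' means finitely generated as a Hopf algebra: $L$ is finitely generated if there is a finite subset of $L$ not contained in any proper Hopf subalgebra of $L$. A subset $L\subset H^0$ separates the points of $H$ if for every non-zero $x\in H$ there is $f\in L$ with $f(x)\neq 0$. *)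

(* Defs.v *)
From HB Require Import structures.
From mathcomp Require Import all_boot all_order all_algebra.
From mathcomp Require Import all_classical.

Set Implicit Arguments.
Unset Strict Implicit.
Unset Printing Implicit Defensive.

Import GRing.Theory.
Local Open Scope ring_scope.
Local Open Scope quotient_scope.

Notation is_bilinear := (bilinear_for *:%R *:%R).

Section BilinearTheory.
Variables (K : fieldType) (U V W : lmodType K) (beta : U -> V -> W).
Hypothesis betaP : is_bilinear beta.

Let b : {bilinear U -> V -> W} :=
  HB.pack beta (bilinear_isBilinear.Build K U V W _ _ beta betaP).

Lemma bil0l v : beta 0 v = 0. Proof. exact: (linear0l b). Qed.
Lemma bil0r u : beta u 0 = 0. Proof. exact: (linear0r b). Qed.
Lemma bilDl v u u' : beta (u + u') v = beta u v + beta u' v.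
Proof. exact: (linearDl b). Qed.
Lemma bilDr u v v' : beta u (v + v') = beta u v + beta u v'.
Proof. exact: (linearDr b). Qed.
Lemma bilZl a u v : beta (a *: u) v = a *: beta u v.
Proof. exact: (linearZl_LR b). Qed.
Lemma bilZr a u v : beta u (a *: v) = a *: beta u v.
Proof. exact: (linearZr_LR b). Qed.
Lemma bil_suml I (r : seq I) (F : I -> U) v :
  beta (\sum_(i <- r) F i) v = \sum_(i <- r) beta (F i) v.
Proof.
by elim: r => [|i r IH]; rewrite ?big_nil ?bil0l // !big_cons bilDl IH.
Qed.
Lemma bil_sumr I (r : seq I) u (F : I -> V) :
  beta u (\sum_(i <- r) F i) = \sum_(i <- r) beta u (F i).
Proof.
by elim: r => [|i r IH]; rewrite ?big_nil ?bil0r // !big_cons bilDr IH.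
Qed.

End BilinearTheory.

(* Tensor product of vector spaces: formal sums of pairs, i.e. lists, modulo
   the congruence generated by commutativity and bilinearity. *)
Section TensorDef.
Variables (K : fieldType) (V W : lmodType K).

Inductive tens_eq : seq (V * W) -> seq (V * W) -> Prop :=
| tens_eq_refl s : tens_eq s s
| tens_eq_sym s t : tens_eq s t -> tens_eq t s
| tens_eq_trans s t u : tens_eq s t -> tens_eq t u -> tens_eq s u
| tens_eq_cat s s' t t' :
    tens_eq s s' -> tens_eq t t' -> tens_eq (s ++ t) (s' ++ t')
| tens_eq_catC s t : tens_eq (s ++ t) (t ++ s)
| tens_eq0 w : tens_eq [:: (0, w)] [::]
| tens_eqDl v v' w : tens_eq [:: (v + v', w)] [:: (v, w); (v', w)]
| tens_eqDr v w w' : tens_eq [:: (v, w + w')] [:: (v, w); (v, w')]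
| tens_eqZ a v w : tens_eq [:: (a *: v, w)] [:: (v, a *: w)].

Let e : rel (seq (V * W)) := fun s t => `[< tens_eq s t >].

Let e_refl : reflexive e.
Proof. by move=> s; apply/asboolP; apply: tens_eq_refl. Qed.
Let e_sym : symmetric e.
Proof. by move=> s t; apply: asbool_equiv_eq; split; apply: tens_eq_sym. Qed.
Let e_trans : transitive e.
Proof.
move=> t s u /asboolP st /asboolP tu; apply/asboolP.
exact: tens_eq_trans st tu.
Qed.

Definition tens_equiv : equiv_rel (seq (V * W)) := EquivRel e e_refl e_sym e_trans.

Definition tensor : Type := {eq_quot tens_equiv}.

HB.instance Definition _ := Choice.on tensor.

Definition tpi (s : seq (V * W)) : tensor := \pi_{eq_quot tens_equiv} s.
Definition trepr (t : tensor) : seq (V * W) := repr (t : {eq_quot tens_equiv}).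

Definition tens (v : V) (w : W) : tensor := tpi [:: (v, w)].

Lemma treprK t : tpi (trepr t) = t.
Proof. exact: reprK. Qed.

Lemma tpiP s t : tpi s = tpi t <-> tens_eq s t.
Proof.
split=> [/eqP|st]; first by rewrite eqmodE => /asboolP.
by apply/eqP; rewrite eqmodE; apply/asboolP.
Qed.

Lemma tens_repr s : tens_eq (trepr (tpi s)) s.
Proof. by apply/tpiP; rewrite treprK. Qed.

Definition tscale_seq (a : K) (s : seq (V * W)) := [seq (a *: p.1, p.2) | p <- s].

Definition tens_zero : tensor := tpi [::].
Definition tens_add (t u : tensor) : tensor := tpi (trepr t ++ trepr u).
Definition tens_scale (a : K) (t : tensor) : tensor := tpi (tscale_seq a (trepr t)).
Definition tens_opp (t : tensor) : tensor := tens_scale (-1) t.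

Local Notation zero := tens_zero.
Local Notation add := tens_add.
Local Notation scale := tens_scale.
Local Notation opp := tens_opp.

Let addE s t : add (tpi s) (tpi t) = tpi (s ++ t).
Proof. by apply/tpiP; apply: tens_eq_cat; apply: tens_repr. Qed.

Let scale_eq a s t : tens_eq s t -> tens_eq (tscale_seq a s) (tscale_seq a t).
Proof.
elim=> {s t} //=.
- by move=> s; apply: tens_eq_refl.
- by move=> s t _; apply: tens_eq_sym.
- by move=> s t u _ st _; apply: tens_eq_trans.
- by move=> s s' t t' _ ss _ tt; rewrite /tscale_seq !map_cat; apply: tens_eq_cat.
- by move=> s t; rewrite /tscale_seq !map_cat; apply: tens_eq_catC.
- by move=> w; rewrite scaler0; apply: tens_eq0.
- by move=> v v' w; rewrite scalerDr; apply: tens_eqDl.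
- by move=> v w w'; apply: tens_eqDr.
- by move=> b v w; rewrite scalerA mulrC -scalerA; apply: tens_eqZ.
Qed.

Let scaleE a s : scale a (tpi s) = tpi (tscale_seq a s).
Proof. by apply/tpiP; apply/scale_eq/tens_repr. Qed.

Lemma tpiW (P : tensor -> Prop) : (forall s, P (tpi s)) -> forall t, P t.
Proof. by move=> Ps t; rewrite -(treprK t). Qed.

Let addA : associative add.
Proof.
by elim/tpiW=> s; elim/tpiW=> t; elim/tpiW=> u; rewrite !addE catA.
Qed.
Let addC : commutative add.
Proof.
elim/tpiW=> s; elim/tpiW=> t; rewrite !addE.
by apply/tpiP; apply: tens_eq_catC.
Qed.
Let add0 : left_id zero add.
Proof. by elim/tpiW=> s; rewrite addE. Qed.

HB.instance Definition _ := GRing.isNmodule.Build tensor addA addC add0.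

Lemma tpi_cat s t : tpi (s ++ t) = tpi s + tpi t.
Proof. by rewrite -addE. Qed.

Lemma tpiE s : tpi s = \sum_(p <- s) tens p.1 p.2.
Proof.
elim: s => [|[v w] s IH]; first by rewrite big_nil.
by rewrite big_cons -IH -cat1s tpi_cat.
Qed.

Let tens0l w : tens 0 w = 0.
Proof. by apply/tpiP; apply: tens_eq0. Qed.
Let tensDl v v' w : tens (v + v') w = tens v w + tens v' w.
Proof. by rewrite -tpi_cat; apply/tpiP; apply: tens_eqDl. Qed.
Let tensDr v w w' : tens v (w + w') = tens v w + tens v w'.
Proof. by rewrite -tpi_cat; apply/tpiP; apply: tens_eqDr. Qed.

Let scaleS a s : scale a (\sum_(p <- s) tens p.1 p.2) =
  \sum_(p <- s) tens (a *: p.1) p.2.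
Proof. by rewrite -tpiE scaleE tpiE big_map. Qed.

Let addN : left_inverse 0 opp +%R.
Proof.
elim/tpiW=> s; rewrite /tens_opp tpiE scaleS -big_split big1 //= => p _.
by rewrite -tensDl scaleN1r addNr tens0l.
Qed.

HB.instance Definition _ := GRing.Nmodule_isZmodule.Build tensor addN.

Let scaleA a b t : scale a (scale b t) = scale (a * b) t.
Proof.
elim/tpiW: t => s; rewrite !scaleE /tscale_seq -map_comp.
by congr (tpi _); apply: eq_map => p /=; rewrite scalerA.
Qed.
Let scale1 : left_id 1 scale.
Proof.
elim/tpiW=> s; rewrite scaleE /tscale_seq; congr (tpi _).
by rewrite -[RHS]map_id; apply: eq_map => -[v w] /=; rewrite scale1r.
Qed.
Let scaleDr : right_distributive scale +%R.
Proof.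
move=> a; elim/tpiW=> s; elim/tpiW=> t.
by rewrite -tpi_cat !scaleE -tpi_cat /tscale_seq map_cat.
Qed.
Let scaleDl t : {morph scale^~ t : a b / a + b}.
Proof.
move=> a b; elim/tpiW: t => s; rewrite tpiE !scaleS -big_split /=.
by apply: eq_bigr => p _; rewrite scalerDl tensDl.
Qed.

HB.instance Definition _ :=
  GRing.Zmodule_isLmodule.Build K tensor scaleA scale1 scaleDr scaleDl.

Lemma tens_bilinear : is_bilinear tens.
Proof.
have Zl a v w : tens (a *: v) w = a *: tens v w.
  by rewrite [RHS]scaleE.
have Zr a v w : tens v (a *: w) = a *: tens v w.
  by rewrite -Zl; apply/esym/tpiP; apply: tens_eqZ.
by split=> [w a v v' | v a w w']; rewrite ?tensDl ?tensDr (Zl, Zr).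
Qed.

End TensorDef.

Notation "v ⊗ w" := (tens v w) (at level 40, left associativity) : ring_scope.

HB.instance Definition _ (K : fieldType) (V W : lmodType K) :=
  bilinear_isBilinear.Build K V W (tensor V W) _ _ (@tens K V W)
    (@tens_bilinear K V W).

Section TensorTheory.
Variables (K : fieldType) (V W : lmodType K).
Implicit Types t u : tensor V W.

Lemma tensorE t : t = \sum_(p <- trepr t) p.1 ⊗ p.2.
Proof. by rewrite -tpiE treprK. Qed.

(* The linear map induced on the tensor product by a bilinear map beta (junk
   when beta is not bilinear). *)
Definition tlift (U : lmodType K) (beta : V -> W -> U) t : U :=
  \sum_(p <- trepr t) beta p.1 p.2.

Section Lift.
Variables (U : lmodType K) (beta : V -> W -> U).
Hypothesis betaP : is_bilinear beta.

Lemma tlift_eq (s t : seq (V * W)) : tens_eq s t ->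
  \sum_(p <- s) beta p.1 p.2 = \sum_(p <- t) beta p.1 p.2.
Proof.
elim=> {s t} [//|s t _ -> //|s t u _ -> _ -> //|s s' t t' _ ss _ tt|s t|w|v v' w|v w w'|a v w].
- by rewrite !big_cat /= ss tt.
- by rewrite !big_cat /= addrC.
- by rewrite big_seq1 big_nil (bil0l betaP).
- by rewrite big_seq1 big_cons big_seq1 (bilDl betaP).
- by rewrite big_seq1 big_cons big_seq1 (bilDr betaP).
- by rewrite !big_seq1 (bilZl betaP) (bilZr betaP).
Qed.

Lemma tlift_sum s :
  tlift beta (\sum_(p <- s) p.1 ⊗ p.2) = \sum_(p <- s) beta p.1 p.2.
Proof. by rewrite -tpiE; apply/tlift_eq/tens_repr. Qed.

Lemma tliftE v w : tlift beta (v ⊗ w) = beta v w.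
Proof. by have := tlift_sum [:: (v, w)]; rewrite !big_seq1. Qed.

Lemma tlift_linear : linear (tlift beta).
Proof.
move=> a t u; rewrite [in LHS](tensorE t) [in LHS](tensorE u) scaler_sumr.
rewrite (eq_bigr (fun p => (a *: p.1) ⊗ p.2)); last first.
  by move=> p _; rewrite linearZl_LR.
rewrite -(big_map (fun p => (a *: p.1, p.2)) predT (fun p => p.1 ⊗ p.2)).
rewrite -big_cat tlift_sum big_cat /= big_map; congr (_ + _).
by rewrite /tlift scaler_sumr; apply: eq_bigr => p _; rewrite (bilZl betaP).
Qed.

End Lift.

Lemma tensor_ind (P : tensor V W -> Prop) :
  P 0 -> (forall t u, P t -> P u -> P (t + u)) -> (forall v w, P (v ⊗ w)) ->
  forall t, P t.
Proof. by move=> P0 PD Pt t; rewrite (tensorE t); elim/big_ind: _. Qed.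

Lemma tensor_ext (U : lmodType K) (f g : tensor V W -> U) :
  linear f -> linear g -> (forall v w, f (v ⊗ w) = g (v ⊗ w)) -> f =1 g.
Proof.
move=> lf lg fg.
pose F : {linear _ -> _} := HB.pack f (GRing.isLinear.Build _ _ _ _ f lf).
pose G : {linear _ -> _} := HB.pack g (GRing.isLinear.Build _ _ _ _ g lg).
move=> t; rewrite (tensorE t).
by rewrite -[LHS]/(F _) -[RHS]/(G _) !raddf_sum; apply: eq_bigr => p _; apply: fg.
Qed.

End TensorTheory.

Section TensorMaps.
Variable K : fieldType.

Lemma tlift_bil (V W X U : lmodType K) (beta : X -> V -> W -> U) :
  (forall x, is_bilinear (beta x)) ->
  (forall v w, linear (fun x => beta x v w)) ->
  is_bilinear (fun t x => tlift (beta x) t).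
Proof.
move=> bP lP; split=> [x|t] a.
  by move=> u v; apply: tlift_linear.
move=> x y /=; rewrite /tlift scaler_sumr -big_split /=.
by apply: eq_bigr => p _; rewrite lP.
Qed.

Lemma bil_flip (V W U : lmodType K) (beta : V -> W -> U) :
  is_bilinear beta -> is_bilinear (fun w v => beta v w).
Proof. by case=> bl br; split. Qed.

Lemma tens_map_bil (V W V' W' : lmodType K) (f : V -> V') (g : W -> W') :
  linear f -> linear g -> is_bilinear (fun v w => f v ⊗ g w).
Proof.
move=> lf lg; split=> [w a v v'|v a w w'].
  by rewrite lf (bilDl (tens_bilinear _ _)) (bilZl (tens_bilinear _ _)).
by rewrite lg (bilDr (tens_bilinear _ _)) (bilZr (tens_bilinear _ _)).
Qed.

Definition tmap (V W V' W' : lmodType K) (f : V -> V') (g : W -> W') :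
  tensor V W -> tensor V' W' := tlift (fun v w => f v ⊗ g w).

Definition tassoc (U V W : lmodType K) :
  tensor (tensor U V) W -> tensor U (tensor V W) :=
  tlift (fun t w => tlift (fun u v => u ⊗ (v ⊗ w)) t).

Lemma tassoc_bil1 (U V W : lmodType K) (w : W) :
  is_bilinear (fun (u : U) (v : V) => u ⊗ (v ⊗ w)).
Proof.
apply: (@tens_map_bil _ _ _ _ id (fun v => v ⊗ w)) => // a v v'.
by rewrite (bilDl (tens_bilinear _ _)) (bilZl (tens_bilinear _ _)).
Qed.

Lemma tassoc_bil (U V W : lmodType K) :
  is_bilinear (fun (t : tensor U V) (w : W) => tlift (fun u v => u ⊗ (v ⊗ w)) t).
Proof.
apply: tlift_bil => [w|u v a w w']; first exact: tassoc_bil1.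
by rewrite !(bilDr (tens_bilinear _ _)) !(bilZr (tens_bilinear _ _)).
Qed.

Lemma tassocE (U V W : lmodType K) (u : U) (v : V) (w : W) :
  tassoc ((u ⊗ v) ⊗ w) = u ⊗ (v ⊗ w).
Proof. by rewrite /tassoc !tliftE //; [exact: tassoc_bil1 | exact: tassoc_bil]. Qed.

End TensorMaps.

Section TensorAlgebra.
Variables (K : fieldType) (A B : algType K).
Implicit Types t u v : tensor A B.

Definition tmul t u : tensor A B :=
  tlift (fun a b => tlift (fun a' b' => (a * a') ⊗ (b * b')) u) t.

Let mulr_lin (C : algType K) (c : C) : linear ( *%R c).
Proof. by move=> k x y; rewrite mulrDr scalerAr. Qed.
Let mull_lin (C : algType K) (c : C) : linear ( *%R^~ c).
Proof. by move=> k x y; rewrite mulrDl scalerAl. Qed.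

Let tmul_bil1 a b : is_bilinear (fun (a' : A) (b' : B) => (a * a') ⊗ (b * b')).
Proof. by apply: tens_map_bil; apply: mulr_lin. Qed.

Let tmul_bil2 u :
  is_bilinear (fun a b => tlift (fun (a' : A) (b' : B) => (a * a') ⊗ (b * b')) u).
Proof.
split=> [b k a a'|a k b b'] /=; rewrite /tlift scaler_sumr -big_split /=;
  apply: eq_bigr => p _.
  have /(_ k a a') := (tens_map_bil (mull_lin p.1) (mull_lin p.2)).1 (b).
  by [].
have /(_ k b b') := (tens_map_bil (mull_lin p.1) (mull_lin p.2)).2 (a).
by [].
Qed.

Lemma tmulE a b a' b' : tmul (a ⊗ b) (a' ⊗ b') = (a * a') ⊗ (b * b').
Proof. by rewrite /tmul tliftE // tliftE. Qed.

Lemma tmul_bilinear : is_bilinear tmul.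
Proof.
apply: (@tlift_bil K A B (tensor A B) _
  (fun u a b => tlift (fun a' b' => (a * a') ⊗ (b * b')) u)) => [u|a b].
  exact: tmul_bil2.
exact: tlift_linear.
Qed.

Let tmul0l := bil0l tmul_bilinear.
Let tmul0r := bil0r tmul_bilinear.

Let tmulDl : left_distributive tmul +%R.
Proof. by move=> t u v; rewrite (bilDl tmul_bilinear). Qed.
Let tmulDr : right_distributive tmul +%R.
Proof. by move=> t u v; rewrite (bilDr tmul_bilinear). Qed.

Let tmulA : associative tmul.
Proof.
move=> t u v; elim/tensor_ind: t => [|t t' IH IH'|a b].
- by rewrite !tmul0l.
- by rewrite !tmulDl IH IH'.
elim/tensor_ind: u => [|t t' IH IH'|a' b'].
- by rewrite !(tmul0l, tmul0r).
- by rewrite !(tmulDl, tmulDr) IH IH'.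
elim/tensor_ind: v => [|t t' IH IH'|a'' b''].
- by rewrite !tmul0r.
- by rewrite !tmulDr IH IH'.
by rewrite !tmulE !mulrA.
Qed.
Let tmul1 : left_id (1 ⊗ 1) tmul.
Proof.
elim/tensor_ind => [|t t' IH IH'|a b]; first by rewrite tmul0r.
  by rewrite tmulDr IH IH'.
by rewrite tmulE !mul1r.
Qed.
Let tmulr1 : right_id (1 ⊗ 1) tmul.
Proof.
elim/tensor_ind => [|t t' IH IH'|a b]; first by rewrite tmul0l.
  by rewrite tmulDl IH IH'.
by rewrite tmulE !mulr1.
Qed.

(* Only a pzRingType: a nzRingType would need 1 ⊗ 1 != 0, which for general
   algebras rests on the existence of a functional that does not kill 1. *)
HB.instance Definition _ := GRing.Zmodule_isPzRing.Build (tensor A B)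
  tmulA tmul1 tmulr1 tmulDl tmulDr.

Lemma tensM (a a' : A) (b b' : B) :
  (a ⊗ b) * (a' ⊗ b') = (a * a') ⊗ (b * b') :> tensor A B.
Proof. exact: tmulE. Qed.

Lemma tens1 : 1 = 1 ⊗ 1 :> tensor A B.
Proof. by []. Qed.

End TensorAlgebra.

HB.mixin Record Algebra_isHopf (K : fieldType) H of GRing.Algebra K H := {
  comul : H -> tensor H H;
  counit : H -> K;
  antipode : H -> H;
  comul_linear : linear comul;
  comul_monoid_morphism : monoid_morphism comul;
  counit_scalar : scalar counit;
  counit_monoid_morphism : monoid_morphism counit;
  antipode_linear : linear antipode;
  comulA : forall x,
    tassoc (tmap comul id (comul x)) = tmap id comul (comul x);
  counitl : forall x, tlift (fun y z => counit y *: z) (comul x) = x;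
  counitr : forall x, tlift (fun y z => counit z *: y) (comul x) = x;
  antipodel : forall x,
    tlift (fun y z => antipode y * z) (comul x) = (counit x)%:A;
  antipoder : forall x,
    tlift (fun y z => y * antipode z) (comul x) = (counit x)%:A
}.

#[short(type="hopfAlgType")]
HB.structure Definition HopfAlgebra (K : fieldType) :=
  {H of GRing.Algebra K H & Algebra_isHopf K H}.

Section Codimension.
Variables (K : fieldType) (V : lmodType K).
Implicit Types P : set V.

Definition is_subspace P :=
  P 0 /\ forall (a : K) x y, P x -> P y -> P (a *: x + y).

(* V / P is spanned by the classes of finitely many vectors. *)
Definition finite_codim P := exists (n : nat) (s : 'I_n -> V),
  forall x, exists c : 'I_n -> K, P (x - \sum_i c i *: s i).

Lemma subspaceD P x y : is_subspace P -> P x -> P y -> P (x + y).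
Proof. by move=> [_ Pl] Px Py; rewrite -[x]scale1r; apply: Pl. Qed.

Lemma subspaceZ P a x : is_subspace P -> P x -> P (a *: x).
Proof. by move=> [P0 Pl] Px; rewrite -[_ *: _]addr0; apply: Pl. Qed.

Lemma subspaceB P x y : is_subspace P -> P x -> P y -> P (x - y).
Proof. by move=> [_ Pl] Px Py; rewrite addrC -scaleN1r; apply: Pl. Qed.

(* A subspace of finite codimension has coordinates modulo P. *)
Lemma finite_codim_coord P : is_subspace P -> finite_codim P ->
  exists s : seq ((V -> K) * V),
    [/\ forall p, p \in s -> scalar p.1,
        forall p x, p \in s -> P x -> p.1 x = 0
      & forall x, P (x - \sum_(p <- s) p.1 x *: p.2)].
Proof.
move=> Ps [n [s sP]]; elim: n P Ps s sP => [|n IH] P Ps s sP.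
  exists [::]; split=> // x; rewrite big_nil.
  by have [c] := sP x; rewrite big_ord0.
pose z := s ord0; pose Q : set V := fun x => exists a, P (x - a *: z).
have PQ x : P x -> Q x by exists 0; rewrite scale0r subr0.
have Qs : is_subspace Q.
  split=> [|a x y [b xb] [c yc]]; first exact/PQ/Ps.1.
  exists (a * b + c); have := Ps.2 a _ _ xb yc.
  by rewrite scalerBr scalerA addrACA -opprD -scalerDl.
have [x|t [lin tQ tP]] := IH Q Qs (fun i => s (lift ord0 i)).
  have [c] := sP x; rewrite big_ord_recl opprD addrA addrAC => Pc.
  by exists (fun i => c (lift ord0 i)); exists (c ord0).
have [Pz|nPz] := pselect (P z).
  exists t; split=> // [p x pt Px|x]; first by apply: tQ pt _; apply: PQ.
  have [a Pa] := tP x.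
  set r := x - _ in Pa *; rewrite -(subrK (a *: z) r).
  exact: subspaceD Pa (subspaceZ _ _ Pz).
have uniq a b x : P (x - a *: z) -> P (x - b *: z) -> a = b.
  move=> xa xb; apply/eqP/negPn/negP; rewrite -subr_eq0 => ab; apply: nPz.
  have := subspaceZ (a - b)^-1 Ps (subspaceB Ps xb xa).
  have -> : x - b *: z - (x - a *: z) = (a - b) *: z.
    by rewrite opprB addrC addrA subrK -scalerBl.
  by rewrite scalerA mulVf // scale1r.
pose psi x := projT1 (cid (tP x)).
have psiP x : P (x - \sum_(p <- t) p.1 x *: p.2 - psi x *: z).
  by rewrite /psi; case: cid.
exists ((psi, z) :: t); split=> [q|q x|x].
- rewrite inE => /orP[/eqP-> a x y /=|/lin//].
  apply: (uniq _ _ (a *: x + y - \sum_(p <- t) p.1 (a *: x + y) *: p.2)).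
    exact: psiP.
  rewrite (_ : _ - _ = a *: (x - \sum_(p <- t) p.1 x *: p.2 - psi x *: z)
     + (y - \sum_(p <- t) p.1 y *: p.2 - psi y *: z)); first exact: Ps.2.
  rewrite !scalerBr scalerA addrACA -opprD scalerDl addrACA -opprD.
  rewrite scaler_sumr -big_split /=; congr (_ - _ - _).
  rewrite !big_seq; apply: eq_bigr => p pt.
  by rewrite lin // scalerDl scalerA.
- rewrite inE => /orP[/eqP-> /= Px|pt Px]; last by apply: tQ pt _; apply: PQ.
  apply: (uniq _ _ x); last by rewrite scale0r subr0.
  have := psiP x; rewrite big_seq big1 ?subr0 // => p pt.
  by rewrite (tQ p) ?scale0r //; apply: PQ.
- by rewrite big_cons /= opprD addrA addrAC.
Qed.

(* The common kernel of finitely many functionals has finite codimension. *)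
Lemma finite_codim_ker (s : seq (V -> K)) P :
  (forall f, f \in s -> scalar f) ->
  (forall x, (forall f, f \in s -> f x = 0) -> P x) ->
  finite_codim P.
Proof.
elim: s P => [|f s IH] P lin sP.
  by exists 0%N, (fun=> 0) => x; exists (fun=> 0); apply: sP.
have lf : scalar f by apply: lin; rewrite inE eqxx.
have ls g : g \in s -> scalar g by move=> gs; apply: lin; rewrite inE gs orbT.
pose Q : set V := fun x => forall g, g \in s -> g x = 0.
have [n [t tQ]] := IH Q ls (fun x => id).
have [[z [zQ fz]]|nz] := pselect (exists z, Q z /\ f z != 0); last first.
  exists n, t => x; have [c Qc] := tQ x; exists c; apply: sP => g.
  rewrite inE => /orP[/eqP->|]; last exact: Qc.
  apply: contrapT => /eqP fx; apply: nz.
  by exists (x - \sum_i c i *: t i).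
exists n.+1, (fun i => oapp t z (unlift ord0 i)) => x; have [c Qc] := tQ x.
set r := x - _ in Qc.
exists (fun i => oapp c (f r / f z) (unlift ord0 i)).
rewrite big_ord_recl unlift_none /=.
under eq_bigr do rewrite liftK /=.
rewrite opprD addrA addrAC -/r; apply: sP => g gs.
have lg := lin _ gs.
rewrite addrC -scaleNr lg; move: gs; rewrite inE => /orP[/eqP->|gs].
  by rewrite mulNr mulfVK // addNr.
by rewrite (Qc g gs) (zQ g gs) mulr0 addr0.
Qed.

End Codimension.

Section HopfTheory.
Variables (K : fieldType) (H : hopfAlgType K).
Implicit Types x y z : H.

Local Notation Delta := (@comul K H).
Local Notation eps := (@counit K H).
Local Notation S := (@antipode K H).
(* Sweedler notation: comul x is the sum of p.1 ⊗ p.2 for p <- sw x. *)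
Local Notation sw x := (trepr (Delta x)).

Lemma lin_sum (V W : lmodType K) (f : V -> W) I (r : seq I) (F : I -> V) :
  linear f -> f (\sum_(i <- r) F i) = \sum_(i <- r) f (F i).
Proof.
move=> lf.
pose g : {linear _ -> _} := HB.pack f (GRing.isLinear.Build _ _ _ _ f lf).
exact: (raddf_sum g).
Qed.

Lemma functional_sum (V : lmodType K) (f : V -> K) I (r : seq I) (F : I -> V) :
  scalar f -> f (\sum_(i <- r) F i) = \sum_(i <- r) f (F i).
Proof.
move=> lf; pose g : {scalar V} := HB.pack f (GRing.isLinear.Build _ _ _ _ f lf).
exact: (raddf_sum g).
Qed.

Lemma functional0 (V : lmodType K) (f : V -> K) : scalar f -> f 0 = 0.
Proof. by move=> /(_ (-1) 0 0); rewrite scaler0 addr0 mulN1r addNr. Qed.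

Lemma functionalZ (V : lmodType K) (f : V -> K) a (v : V) :
  scalar f -> f (a *: v) = a * f v.
Proof. by move=> lf; rewrite -[a *: v]addr0 lf functional0 ?addr0. Qed.

Lemma mul_biscalar (V W : lmodType K) (f : V -> K) (g : W -> K) :
  scalar f -> scalar g -> is_bilinear (fun v w => f v * g w : K^o).
Proof.
move=> lf lg; split=> [w|v] a x y; first by rewrite lf mulrDl -mulrA.
by rewrite lg mulrDr mulrCA.
Qed.

Lemma sw_linear (U : lmodType K) (beta : H -> H -> U) : is_bilinear beta ->
  linear (fun x => \sum_(p <- sw x) beta p.1 p.2).
Proof.
by move=> b a x y; rewrite -!/(tlift beta _) comul_linear tlift_linear.
Qed.

Lemma swM (U : lmodType K) (beta : H -> H -> U) x y : is_bilinear beta ->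
  \sum_(p <- sw (x * y)) beta p.1 p.2 =
  \sum_(p <- sw x) \sum_(q <- sw y) beta (p.1 * q.1) (p.2 * q.2).
Proof.
move=> b; rewrite -/(tlift beta _) comul_monoid_morphism.2.
rewrite {1}(tensorE (Delta x)) mulr_suml (lin_sum _ _ (tlift_linear b)).
apply: eq_bigr => p _.
rewrite {1}(tensorE (Delta y)) mulr_sumr (lin_sum _ _ (tlift_linear b)).
by apply: eq_bigr => q _; rewrite tensM tliftE.
Qed.

Lemma sw1 (U : lmodType K) (beta : H -> H -> U) : is_bilinear beta ->
  \sum_(p <- sw 1) beta p.1 p.2 = beta 1 1.
Proof.
by move=> b; rewrite -/(tlift beta _) comul_monoid_morphism.1 tens1 tliftE.
Qed.

Lemma swA (U : lmodType K) (beta : H -> H -> H -> U) x :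
  (forall c, is_bilinear (fun a b => beta a b c)) ->
  (forall a b, linear (beta a b)) ->
  \sum_(p <- sw x) \sum_(q <- sw p.1) beta q.1 q.2 p.2 =
  \sum_(p <- sw x) \sum_(q <- sw p.2) beta p.1 q.1 q.2.
Proof.
move=> b12 b3.
have b23 a : is_bilinear (beta a).
  by split=> [c|b]; [apply: (b12 c).2 | apply: b3].
have bL : is_bilinear (fun a t => tlift (beta a) t).
  apply: bil_flip; apply: (tlift_bil (beta := beta)) => // b c.
  exact: (b12 c).1.
pose L := tlift (fun a t => tlift (beta a) t).
have linL : linear L by apply: tlift_linear.
have E : L (tassoc (tmap Delta id (Delta x))) =
  L (\sum_(p <- sw x) p.1 ⊗ Delta p.2) := congr1 L (comulA x).
rewrite [RHS](lin_sum _ _ linL) in E.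
transitivity (L (tassoc (tlift (fun v w => Delta v ⊗ id w) (Delta x)))).
  rewrite [tlift _ (Delta x)]/tlift /tassoc (lin_sum _ _ (tlift_linear (@tassoc_bil _ _ _ _))).
  rewrite (lin_sum _ _ linL); apply: eq_bigr => p _.
  rewrite tliftE; last exact: tassoc_bil.
  rewrite [tlift _ (Delta _)]/tlift (lin_sum _ _ linL); apply: eq_bigr => q _.
  by rewrite /L !tliftE.
by rewrite [LHS]E; apply: eq_bigr => p _; rewrite /L tliftE.
Qed.

Lemma sw_counitl x : \sum_(p <- sw x) eps p.1 *: p.2 = x.
Proof. exact: counitl. Qed.
Lemma sw_counitr x : \sum_(p <- sw x) eps p.2 *: p.1 = x.
Proof. exact: counitr. Qed.
Lemma sw_antipodel x : \sum_(p <- sw x) S p.1 * p.2 = (eps x)%:A.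
Proof. exact: antipodel. Qed.
Lemma sw_antipoder x : \sum_(p <- sw x) p.1 * S p.2 = (eps x)%:A.
Proof. exact: antipoder. Qed.

Lemma antipodeDZ a x y : S (a *: x + y) = a *: S x + S y.
Proof. exact: antipode_linear. Qed.
Lemma antipodeZ a x : S (a *: x) = a *: S x.
Proof.
pose g : {linear _ -> _} :=
  HB.pack S (GRing.isLinear.Build _ _ _ _ S (@antipode_linear K H)).
exact: (linearZ_LR g).
Qed.
Lemma antipode_sum I (r : seq I) (F : I -> H) :
  S (\sum_(i <- r) F i) = \sum_(i <- r) S (F i).
Proof. exact: (lin_sum _ _ (@antipode_linear K H)). Qed.

Lemma counitM x y : eps (x * y) = eps x * eps y.
Proof. exact: counit_monoid_morphism.2. Qed.
Lemma counit1 : eps 1 = 1.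
Proof. exact: counit_monoid_morphism.1. Qed.

Lemma mul_bil : is_bilinear (fun x y => x * y).
Proof.
split=> [x|y] a u v /=; first by rewrite mulrDl scalerAl.
by rewrite mulrDr scalerAr.
Qed.

Lemma antipode_mul_bil : is_bilinear (fun x y => S x * y).
Proof.
split=> [x|y] a u v /=; first by rewrite antipodeDZ mulrDl scalerAl.
by rewrite mulrDr scalerAr.
Qed.

Lemma antipodeM x y : S (x * y) = S y * S x.
Proof.
pose T a b c d e f := S (a * b) * (c * d) * (S e * S f).
have E1 c f : \sum_(p <- sw c) \sum_(q <- sw f) S (p.1 * q.1) * (p.2 * q.2)
   = (eps c * eps f)%:A.
  by rewrite -(swM _ _ antipode_mul_bil) sw_antipodel counitM.
have E2 c f : \sum_(p <- sw c) \sum_(q <- sw f) (p.1 * q.1) * (S q.2 * S p.2)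
   = (eps c * eps f)%:A.
  transitivity (\sum_(p <- sw c) eps f *: (p.1 * S p.2)).
    apply: eq_bigr => p _; transitivity (p.1 * (eps f)%:A * S p.2).
      rewrite -sw_antipoder mulr_sumr mulr_suml; apply: eq_bigr => q _.
      by rewrite !mulrA.
    by rewrite mulr_algr scalerAl.
  by rewrite -scaler_sumr sw_antipoder scalerA mulrC.
(* both bracketings of the convolution of S(xy), xy and S(y)S(x) *)
transitivity (\sum_(p <- sw x) \sum_(q <- sw p.2)
   \sum_(r <- sw y) \sum_(s <- sw r.2) T p.1 r.1 q.1 s.1 s.2 q.2).
  transitivity (\sum_(p <- sw x) \sum_(r <- sw y)
      (eps p.2 * eps r.2) *: S (p.1 * r.1)).
    rewrite -{1}(sw_counitr x) -{1}(sw_counitr y) mulr_suml antipode_sum.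
    apply: eq_bigr => p _; rewrite mulr_sumr antipode_sum.
    by apply: eq_bigr => r _; rewrite -scalerAl -scalerAr !antipodeZ scalerA.
  apply: eq_bigr => p _; rewrite exchange_big /=; apply: eq_bigr => r _.
  rewrite -[RHS]/(\sum_(q <- sw p.2) \sum_(s <- sw r.2)
    S (p.1 * r.1) * (q.1 * s.1) * (S s.2 * S q.2)).
  rewrite -mulr_algr -E2 mulr_sumr; apply: eq_bigr => q _.
  by rewrite mulr_sumr; apply: eq_bigr => s _; rewrite !mulrA.
symmetry; transitivity (\sum_(p <- sw x) \sum_(q <- sw p.1)
   \sum_(r <- sw y) \sum_(s <- sw r.1) T q.1 s.1 q.2 s.2 r.2 p.2).
  transitivity (\sum_(p <- sw x) \sum_(r <- sw y)
      (eps p.1 * eps r.1) *: (S r.2 * S p.2)).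
    rewrite -{1}(sw_counitl x) -{1}(sw_counitl y) !antipode_sum mulr_sumr.
    apply: eq_bigr => p _; rewrite mulr_suml.
    by apply: eq_bigr => r _; rewrite !antipodeZ -scalerAl -scalerAr scalerA mulrC.
  apply: eq_bigr => p _; rewrite exchange_big /=; apply: eq_bigr => r _.
  rewrite -[RHS]/(\sum_(q <- sw p.1) \sum_(s <- sw r.1)
    S (q.1 * s.1) * (q.2 * s.2) * (S r.2 * S p.2)).
  rewrite -mulr_algl -E1 mulr_suml; apply: eq_bigr => q _.
  by rewrite mulr_suml.
transitivity (\sum_(p <- sw x) \sum_(q <- sw p.1)
   \sum_(r <- sw y) \sum_(s <- sw r.2) T q.1 r.1 q.2 s.1 s.2 p.2).
  apply: eq_bigr => p _; apply: eq_bigr => q _.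
  apply: (swA (beta := fun b d e => T q.1 b q.2 d e p.2)) => [e|b d].
    split=> [d|b] a u v; rewrite /T.
      by rewrite mulrDr -scalerAr antipodeDZ !mulrDl -!scalerAl.
    by rewrite mulrDr -scalerAr mulrDr -scalerAr mulrDl -scalerAl.
  by move=> a u v; rewrite /T antipodeDZ mulrDl -scalerAl mulrDr -scalerAr.
apply: (swA (beta := fun a c f => \sum_(r <- sw y) \sum_(s <- sw r.2)
  T a r.1 c s.1 s.2 f)) => [f|b d].
  split=> [d|b] a u v /=; rewrite scaler_sumr -big_split /=; apply: eq_bigr => r _;
    rewrite scaler_sumr -big_split /=; apply: eq_bigr => s _; rewrite /T.
    by rewrite mulrDl -scalerAl antipodeDZ !mulrDl -!scalerAl.
  by rewrite mulrDl -scalerAl mulrDr -scalerAr mulrDl -scalerAl.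
move=> a u v /=; rewrite scaler_sumr -big_split /=; apply: eq_bigr => r _;
  rewrite scaler_sumr -big_split /=; apply: eq_bigr => s _; rewrite /T.
by rewrite antipodeDZ mulrDr -scalerAr mulrDr -scalerAr.
Qed.

Lemma antipode1 : S 1 = 1.
Proof.
have := sw_antipodel 1; rewrite (sw1 antipode_mul_bil) counit1 mulr1.
by rewrite scale1r.
Qed.

Lemma counit_antipode x : eps (S x) = eps x.
Proof.
have le := @counit_scalar K H.
have := congr1 eps (sw_antipodel x).
rewrite [in RHS](functionalZ _ _ le) counit1 mulr1 (functional_sum _ _ le) => <-.
rewrite -{1}(sw_counitr x) antipode_sum (functional_sum _ _ le).
apply: eq_bigr => p _; rewrite antipodeZ (functionalZ _ _ le) counitM.
exact: mulrC.
Qed.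

End HopfTheory.

Definition two_sided_ideal (K : fieldType) (A : algType K) (I : set A) :=
  is_subspace I /\ forall a x b, I x -> I (a * x * b).

Section HopfDual.
Variables (K : fieldType) (H : hopfAlgType K).
Implicit Types x y z : H.

Local Notation Delta := (@comul K H).
Local Notation eps := (@counit K H).
Local Notation S := (@antipode K H).
Local Notation sw x := (trepr (Delta x)).

Definition in_hopf_dual (f : H -> K) := scalar f /\
  exists I : set H, [/\ two_sided_ideal I, finite_codim I
    & forall x, I x -> f x = 0].

(* The functionals f such that f (x * y) is a sum of products g x * h y are
   exactly those of the Hopf dual; the factors may be taken there as well. *)
Lemma in_hopf_dual_split (f : H -> K) : in_hopf_dual f ->
  exists s : seq ((H -> K) * (H -> K)),
    (forall p, p \in s -> in_hopf_dual p.1 /\ in_hopf_dual p.2) /\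
    forall x y, f (x * y) = \sum_(p <- s) p.1 x * p.2 y.
Proof.
move=> [lf [I [iI cI If]]].
have [s [ls sI sP]] := finite_codim_coord iI.1 cI.
exists [seq (p.1, fun y => f (p.2 * y)) | p <- s]; split=> [_ /mapP[p ps ->]|x y].
  split; split.
  - exact: ls.
  - by exists I; split=> // x; apply: sI.
  - by move=> a x y /=; rewrite mulrDr -scalerAr lf.
  - exists I; split=> // x Ix /=; apply: If.
    by have := iI.2 p.2 x 1 Ix; rewrite mulr1.
rewrite big_map /=.
have /(iI.2 1 _ y) := sP x; rewrite mul1r => /If.
rewrite mulrBl -scaleN1r addrC lf mulN1r => /eqP; rewrite addrC subr_eq0 => /eqP->.
rewrite mulr_suml (functional_sum _ _ lf); apply: eq_bigr => p _.
by rewrite -scalerAl (functionalZ _ _ lf).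
Qed.

Lemma split_in_hopf_dual (f : H -> K) (s : seq ((H -> K) * (H -> K))) :
  scalar f -> (forall p, p \in s -> scalar p.2) ->
  (forall x y, f (x * y) = \sum_(p <- s) p.1 x * p.2 y) -> in_hopf_dual f.
Proof.
move=> lf ls fs; split=> //.
pose L : set H := fun y => forall x, f (x * y) = 0.
have [n [t tL]] : finite_codim L.
  apply: (finite_codim_ker (s := [seq p.2 | p <- s])) => [_ /mapP[p ps ->]|y sy x].
    exact: ls.
  rewrite fs big_seq big1 // => p ps; rewrite sy ?mulr0 //.
  by apply/mapP; exists p.
exists (fun a => forall x b, f (x * a * b) = 0); split.
- split; first split=> [x b|k a a' fa fa' x b].
  + by rewrite mulr0 mul0r functional0.
  + by rewrite mulrDr mulrDl -scalerAr -scalerAl lf fa fa' mulr0 addr0.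
  + by move=> a x b fx y c; rewrite !mulrA -(mulrA _ b) fx.
- apply: (finite_codim_ker
    (s := [seq (fun a => p.2 (a * t i)) | p <- s, i <- enum 'I_n])).
    move=> _ /allpairsP[[p i] /= [ps _ ->]] a x y.
    by rewrite mulrDl -scalerAl ls.
  move=> a fa x b; have [c /(_ (x * a))] := tL b.
  rewrite mulrBr -scaleN1r addrC lf mulN1r => /eqP.
  rewrite addrC subr_eq0 => /eqP->.
  rewrite mulr_sumr (functional_sum _ _ lf) big1 // => i _.
  rewrite -scalerAr (functionalZ _ _ lf) -mulrA fs big_seq big1 ?mulr0 // => p ps.
  rewrite [p.2 _](fa (fun a => p.2 (a * t i))) ?mulr0 //.
  by apply/allpairsP; exists (p, i); rewrite mem_enum.
- by move=> x /(_ 1 1); rewrite mul1r mulr1.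
Qed.

(* K^o rather than K, so that H -> K^o carries its pointwise lmodType K. *)
Definition hopf_dual_pred : {pred H -> K^o} := fun f => `[< in_hopf_dual f >].

Lemma hopf_dual_submod : submod_closed hopf_dual_pred.
Proof.
split=> [|k f g /asboolP Df /asboolP Dg]; apply/asboolP.
  apply: (split_in_hopf_dual (s := [::])) => [a x y|//|x y] /=.
    by rewrite mulr0 addr0.
  by rewrite big_nil.
have [s [sD fs]] := in_hopf_dual_split Df.
have [t [tD gt]] := in_hopf_dual_split Dg.
apply: (split_in_hopf_dual (s := [seq (fun x => k * p.1 x, p.2) | p <- s] ++ t)).
- move=> a x y; rewrite !fctE /= Df.1 Dg.1 /= scalerDr mulrDr addrACA.
  by rewrite [k *: _]mulrCA.
- move=> p; rewrite mem_cat => /orP[/mapP[q qs ->]|pt] /=.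
    exact: (sD q qs).2.1.
  exact: (tD p pt).2.1.
move=> x y; rewrite big_cat big_map /= !fctE fs gt; congr (_ + _).
by rewrite [_ *: _]mulr_sumr; apply: eq_bigr => p _; rewrite mulrA.
Qed.

HB.instance Definition _ :=
  GRing.isSubmodClosed.Build K (H -> K^o) hopf_dual_pred
    (GRing.submod_closed_semi hopf_dual_submod).

Record hopf_dual := HopfDual {
  hopf_dual_fun :> H -> K^o;
  _ : hopf_dual_fun \in hopf_dual_pred
}.

HB.instance Definition _ := [isSub for hopf_dual_fun].
HB.instance Definition _ := [Choice of hopf_dual by <:].
HB.instance Definition _ := [SubChoice_isSubLmodule of hopf_dual by <:].
Implicit Types f g h : hopf_dual.

Lemma hopf_dualP f : in_hopf_dual f.
Proof. by case: f => f /= /asboolP. Qed.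

Lemma hopf_dual_scalar f : scalar f.
Proof. exact: (hopf_dualP f).1. Qed.

Lemma hopf_dual_ext f g : (forall x, f x = g x) -> f = g.
Proof. by move=> fg; apply/val_inj/funext. Qed.

Definition mk_hopf_dual (f : H -> K) (Df : in_hopf_dual f) : hopf_dual :=
  HopfDual (introT (asboolP _) Df).

Lemma hopf_dual_lin (a : K) f g x : (a *: f + g) x = a * f x + g x.
Proof. by []. Qed.

Lemma hopf_dual_split f : exists s : seq (hopf_dual * hopf_dual),
  forall x y, f (x * y) = \sum_(p <- s) p.1 x * p.2 y.
Proof.
have [s [sD fs]] := in_hopf_dual_split (hopf_dualP f).
suff [t tE] : exists t : seq (hopf_dual * hopf_dual),
    s = [seq (hopf_dual_fun p.1, hopf_dual_fun p.2) | p <- t].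
  by exists t => x y; rewrite fs tE big_map.
elim: s sD {fs} => [|[g h] s IH] sD; first by exists [::].
have [|t ->] := IH; first by move=> p ps; apply: sD; rewrite inE ps orbT.
have [Dg Dh] := sD (g, h) (mem_head _ _).
by exists ((mk_hopf_dual Dg, mk_hopf_dual Dh) :: t).
Qed.

(* Evaluation of a tensor of functionals at a pair of points *)
Definition tev (t : tensor hopf_dual hopf_dual) x y : K^o :=
  tlift (fun f g => f x * g y : K^o) t.

Lemma ev_bil x y : is_bilinear (fun f g => f x * g y : K^o).
Proof.
split=> [g|f] a u v.
  by rewrite -[LHS]/((a * u x + v x) * g y) mulrDl -mulrA.
by rewrite -[LHS]/(f x * (a * u y + v y)) mulrDr mulrCA.
Qed.

Lemma tevE f g x y : tev (f ⊗ g) x y = f x * g y.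
Proof. exact/tliftE/ev_bil. Qed.

Lemma tev_linear x y : linear (fun t => tev t x y).
Proof. exact/tlift_linear/ev_bil. Qed.

End HopfDual.

Section TensorSeparation.
Variables (K : fieldType) (V W : lmodType K) (X Y : Type).
Variables (i : V -> X -> K) (j : W -> Y -> K).
Hypothesis i_scalar : forall x, scalar (i^~ x).
Hypothesis j_scalar : forall y, scalar (j^~ y).
Hypothesis i_inj : forall v, (forall x, i v x = 0) -> v = 0.
Hypothesis j_inj : forall w, (forall y, j w y = 0) -> w = 0.

Lemma tensor_sep (t : tensor V W) :
  (forall x y, tlift (fun v w => i v x * j w y : K^o) t = 0) -> t = 0.
Proof.
rewrite [in _ = 0](tensorE t) /tlift.
move: (trepr t) => s; have [n] := ubnP (size s).
elim: n s => // n IH [|p s] /= szs E; first by rewrite big_nil.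
have [[c pc]|np] := pselect (exists c : V * W -> K, p.1 = \sum_(q <- s) c q *: q.1).
  pose s' := [seq (q.1, q.2 + c q *: p.2) | q <- s].
  have -> : \sum_(q <- p :: s) q.1 ⊗ q.2 = \sum_(q <- s') q.1 ⊗ q.2.
    rewrite big_cons pc (bil_suml (tens_bilinear _ _)) big_map -big_split /=.
    apply: eq_bigr => q _; rewrite (bilDr (tens_bilinear _ _)).
    by rewrite (bilZl (tens_bilinear _ _)) (bilZr (tens_bilinear _ _)) addrC.
  apply: IH => [|x y]; first by rewrite size_map.
  rewrite -[RHS](E x y) big_cons pc (functional_sum _ _ (i_scalar x)) mulr_suml.
  rewrite big_map -big_split /=; apply: eq_bigr => q _.
  rewrite (functionalZ _ _ (i_scalar x)) [q.2 + _]addrC.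
  by rewrite j_scalar mulrDr mulrCA mulrA.
have p0 : p.2 = 0.
  apply: j_inj => y; apply/eqP/negPn/negP => py; apply: np.
  exists (fun q => - (j q.2 y / j p.2 y)); apply/eqP; rewrite -subr_eq0; apply/eqP.
  apply: i_inj => x; apply: (mulIf py); rewrite mul0r -[RHS](E x y) big_cons.
  rewrite addrC -scaleN1r i_scalar mulN1r (functional_sum _ _ (i_scalar x)).
  rewrite mulrDl addrC; congr (_ + _).
  rewrite -sumrN mulr_suml; apply: eq_bigr => q _.
  by rewrite (functionalZ _ _ (i_scalar x)) !mulNr opprK mulrAC mulfVK // mulrC.
rewrite big_cons p0 (bil0r (tens_bilinear _ _)) add0r; apply: IH => // x y.
by rewrite -[RHS](E x y) big_cons p0 (functional0 (j_scalar y)) mulr0 add0r.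
Qed.

End TensorSeparation.

Section HopfDualStructure.
Variables (K : fieldType) (H : hopfAlgType K).
Implicit Types (x y z : H) (f g h : hopf_dual H).

Local Notation Delta := (@comul K H).
Local Notation eps := (@counit K H).
Local Notation S := (@antipode K H).
Local Notation sw x := (trepr (Delta x)).
Local Notation D := (hopf_dual H).

Lemma tev_inj (t u : tensor D D) : (forall x y, tev t x y = tev u x y) -> t = u.
Proof.
move=> tu; apply/eqP; rewrite -subr_eq0; apply/eqP.
apply: (tensor_sep (i := fun f x => f x) (j := fun f x => f x)) => [x|x|f f0|f f0|x y].
- by move=> a f g; apply: hopf_dual_lin.
- by move=> a f g; apply: hopf_dual_lin.
- by apply: hopf_dual_ext => x; rewrite f0.
- by apply: hopf_dual_ext => x; rewrite f0.
by rewrite -scaleN1r addrC -/(tev _ x y) tev_linear tu scaleN1r addNr.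
Qed.

Definition tev3 (t : tensor D (tensor D D)) x y z : K^o :=
  tlift (fun f u => f x * tev u y z : K^o) t.

Lemma ev3_bil x y z : is_bilinear (fun f u => f x * tev u y z : K^o).
Proof.
split=> [u|f] a v w.
  by rewrite -[LHS]/((a * v x + w x) * tev u y z) mulrDl -mulrA.
by rewrite /= tev_linear mulrDr mulrCA.
Qed.

Lemma tev3_linear x y z : linear (fun t => tev3 t x y z).
Proof. exact/tlift_linear/ev3_bil. Qed.

Lemma tev3E f u x y z : tev3 (f ⊗ u) x y z = f x * tev u y z.
Proof. exact/tliftE/ev3_bil. Qed.

Lemma tev3_inj (t u : tensor D (tensor D D)) :
  (forall x y z, tev3 t x y z = tev3 u x y z) -> t = u.
Proof.
move=> tu; apply/eqP; rewrite -subr_eq0; apply/eqP.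
apply: (tensor_sep (i := fun f x => f x)
  (j := fun u (p : H * H) => tev u p.1 p.2)) => [x|[y z]|f f0|v v0|x [y z]].
- by move=> a f g; apply: hopf_dual_lin.
- by move=> a v w; apply: tev_linear.
- by apply: hopf_dual_ext => x; rewrite f0.
- apply: tev_inj => x y; rewrite (v0 (x, y)).
  by rewrite (functional0 (tev_linear x y)).
by rewrite -scaleN1r addrC -/(tev3 _ x y z) tev3_linear tu scaleN1r addNr.
Qed.

Definition conv (f g : H -> K) x : K := \sum_(p <- sw x) f p.1 * g p.2.

Lemma conv_scalar (f g : H -> K) : scalar f -> scalar g -> scalar (conv f g).
Proof. by move=> lf lg; exact: (sw_linear (U := K^o) (mul_biscalar lf lg)). Qed.

Lemma convM (f g : H -> K) x y : scalar f -> scalar g ->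
  conv f g (x * y) =
  \sum_(p <- sw x) \sum_(q <- sw y) f (p.1 * q.1) * g (p.2 * q.2).
Proof. by move=> lf lg; exact: (swM (U := K^o) _ _ (mul_biscalar lf lg)). Qed.

Lemma conv_split (s t : seq (D * D)) (f g : H -> K) x y :
  scalar f -> scalar g ->
  (forall x y, f (x * y) = \sum_(p <- s) p.1 x * p.2 y) ->
  (forall x y, g (x * y) = \sum_(p <- t) p.1 x * p.2 y) ->
  conv f g (x * y) =
  \sum_(p <- s) \sum_(q <- t) conv p.1 q.1 x * conv p.2 q.2 y.
Proof.
move=> lf lg fs gt; rewrite convM //.
transitivity (\sum_(p <- s) \sum_(q <- t) \sum_(a <- sw x) \sum_(b <- sw y)
  (p.1 a.1 * q.1 a.2) * (p.2 b.1 * q.2 b.2)); last first.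
  apply: eq_bigr => p _; apply: eq_bigr => q _; rewrite mulr_suml.
  by apply: eq_bigr => a _; rewrite mulr_sumr.
under [RHS]eq_bigr do rewrite exchange_big /=.
rewrite [RHS]exchange_big /=; apply: eq_bigr => a _.
transitivity (\sum_(p <- s) \sum_(b <- sw y) \sum_(q <- t)
  (p.1 a.1 * q.1 a.2) * (p.2 b.1 * q.2 b.2)); last first.
  by apply: eq_bigr => p _; rewrite exchange_big.
rewrite [RHS]exchange_big /=; apply: eq_bigr => b _.
rewrite fs gt mulr_suml; apply: eq_bigr => p _.
by rewrite mulr_sumr; apply: eq_bigr => q _; rewrite mulrACA.
Qed.

Lemma conv_in_dual f g : in_hopf_dual (conv f g).
Proof.
have [s fs] := hopf_dual_split f; have [t gt] := hopf_dual_split g.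
pose r := allpairs (fun p q : D * D => (conv p.1 q.1, conv p.2 q.2)) s t.
apply: (split_in_hopf_dual (s := r)) => [||x y].
- exact: conv_scalar (hopf_dual_scalar f) (hopf_dual_scalar g).
- move=> _ /allpairsP[[p q] /= [_ _ ->]] /=.
  exact: conv_scalar (hopf_dual_scalar _) (hopf_dual_scalar _).
rewrite (conv_split _ _ (hopf_dual_scalar f) (hopf_dual_scalar g) fs gt).
by rewrite big_allpairs_dep.
Qed.

Definition dual_mul f g : D := mk_hopf_dual (conv_in_dual f g).

Lemma counit_in_dual : in_hopf_dual eps.
Proof.
apply: (split_in_hopf_dual (s := [:: (eps, eps)])) => [|p|x y].
- exact: counit_scalar.
- by rewrite inE => /eqP-> /=; apply: counit_scalar.
by rewrite big_seq1 counitM.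
Qed.

Definition dual_one : D := mk_hopf_dual counit_in_dual.

Lemma antipode_in_dual f : in_hopf_dual (f \o S).
Proof.
have [s fs] := hopf_dual_split f.
have lS g : scalar (g \o S).
  by move=> a x y /=; rewrite antipodeDZ hopf_dual_scalar.
apply: (split_in_hopf_dual
  (s := [seq (hopf_dual_fun p.2 \o S, hopf_dual_fun p.1 \o S) | p <- s])) => [||x y].
- exact: lS.
- by move=> _ /mapP[p _ ->]; apply: lS.
rewrite big_map /= antipodeM fs; apply: eq_bigr => p _; exact: mulrC.
Qed.

Definition dual_antipode f : D := mk_hopf_dual (antipode_in_dual f).

Let dual_mulA : associative dual_mul.
Proof.
move=> f g h; apply: hopf_dual_ext => x /=.
rewrite /conv /=; symmetry.
transitivity (\sum_(p <- sw x) \sum_(q <- sw p.1) f q.1 * g q.2 * h p.2 : K^o).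
  by apply: eq_bigr => p _; rewrite mulr_suml.
rewrite (swA (U := K^o) (beta := fun a b c => f a * g b * h c)).
- by apply: eq_bigr => p _; rewrite mulr_sumr; apply: eq_bigr => q _; rewrite mulrA.
- move=> c; split=> [b|a] k u v /=.
    by rewrite hopf_dual_scalar !mulrDl -!mulrA.
  rewrite hopf_dual_scalar mulrDr mulrDl; congr (_ + _).
  by rewrite [f _ * _]mulrCA -[LHS]mulrA.
by move=> a b k u v /=; rewrite hopf_dual_scalar mulrDr mulrCA.
Qed.

Let dual_mul1 : left_id dual_one dual_mul.
Proof.
move=> f; apply: hopf_dual_ext => x /=.
rewrite -[in RHS](sw_counitl x) (functional_sum _ _ (hopf_dual_scalar f)).
by apply: eq_bigr => p _; rewrite (functionalZ _ _ (hopf_dual_scalar f)).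
Qed.

Let dual_mulr1 : right_id dual_one dual_mul.
Proof.
move=> f; apply: hopf_dual_ext => x /=.
rewrite -[in RHS](sw_counitr x) (functional_sum _ _ (hopf_dual_scalar f)).
by apply: eq_bigr => p _; rewrite (functionalZ _ _ (hopf_dual_scalar f)) mulrC.
Qed.

Let dual_mulDl : left_distributive dual_mul +%R.
Proof.
move=> f g h; apply: hopf_dual_ext => x.
rewrite -[RHS]/(conv f h x + conv g h x) -big_split /=.
by apply: eq_bigr => p _; rewrite -mulrDl.
Qed.

Let dual_mulDr : right_distributive dual_mul +%R.
Proof.
move=> f g h; apply: hopf_dual_ext => x.
rewrite -[RHS]/(conv f g x + conv f h x) -big_split /=.
by apply: eq_bigr => p _; rewrite -mulrDr.
Qed.

Let dual_one_neq0 : dual_one != 0.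
Proof.
apply/eqP => /(congr1 (fun f : D => f 1)) /= /eqP.
by rewrite counit1 oner_eq0.
Qed.

HB.instance Definition _ := GRing.Zmodule_isNzRing.Build D
  dual_mulA dual_mul1 dual_mulr1 dual_mulDl dual_mulDr dual_one_neq0.

Let dual_scalerAl a f g : a *: (f * g) = (a *: f) * g.
Proof.
apply: hopf_dual_ext => x; rewrite -[LHS]/(a * conv f g x) /= mulr_sumr.
by apply: eq_bigr => p _; rewrite mulrA.
Qed.

HB.instance Definition _ := GRing.Lmodule_isLalgebra.Build K D dual_scalerAl.

Let dual_scalerAr a f g : a *: (f * g) = f * (a *: g).
Proof.
apply: hopf_dual_ext => x; rewrite -[LHS]/(a * conv f g x) /= mulr_sumr.
by apply: eq_bigr => p _; rewrite mulrCA.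
Qed.

HB.instance Definition _ := GRing.Lalgebra_isAlgebra.Build K D dual_scalerAr.

Lemma dual_mulE f g x : (f * g) x = \sum_(p <- sw x) f p.1 * g p.2.
Proof. by []. Qed.

Lemma dual_oneE x : (1 : D) x = eps x.
Proof. by []. Qed.

Lemma dual_comul_ex f : exists t : tensor D D, forall x y, tev t x y = f (x * y).
Proof.
have [s fs] := hopf_dual_split f.
by exists (\sum_(p <- s) p.1 ⊗ p.2) => x y; rewrite /tev tlift_sum ?fs //; exact: ev_bil.
Qed.

(* The tensor \sum_i g_i ⊗ h_i with f (x * y) = \sum_i g_i x * h_i y. *)
Definition dual_comul f : tensor D D := projT1 (cid (dual_comul_ex f)).

Lemma tev_comul f x y : tev (dual_comul f) x y = f (x * y).
Proof. by rewrite /dual_comul; case: cid => t /= ->. Qed.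

Definition dual_counit f : K := f 1.

Lemma tevM (t u : tensor D D) x y :
  tev (t * u) x y =
  \sum_(p <- sw x) \sum_(q <- sw y) tev t p.1 q.1 * tev u p.2 q.2.
Proof.
elim/tensor_ind: t => [|t t' IH IH'|f f'].
- rewrite mul0r big1 => [|p _]; last rewrite big1 // => q _.
    exact: (functional0 (tev_linear x y)).
  by rewrite (functional0 (tev_linear p.1 q.1)) mul0r.
- have tevD v w a b : tev (v + w) a b = tev v a b + tev w a b.
    by rewrite -[v]scale1r tev_linear !scale1r.
  rewrite mulrDl tevD IH IH' -big_split; apply: eq_bigr => p _.
  by rewrite -big_split; apply: eq_bigr => q _; rewrite tevD mulrDl.
elim/tensor_ind: u => [|t t' IH IH'|g g'].
- rewrite mulr0 big1 => [|p _]; last rewrite big1 // => q _.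
    exact: (functional0 (tev_linear x y)).
  by rewrite (functional0 (tev_linear p.2 q.2)) mulr0.
- have tevD v w a b : tev (v + w) a b = tev v a b + tev w a b.
    by rewrite -[v]scale1r tev_linear !scale1r.
  rewrite mulrDr tevD IH IH' -big_split; apply: eq_bigr => p _.
  by rewrite -big_split; apply: eq_bigr => q _; rewrite tevD mulrDr.
rewrite tensM tevE !dual_mulE mulr_suml; apply: eq_bigr => p _.
by rewrite mulr_sumr; apply: eq_bigr => q _; rewrite !tevE mulrACA.
Qed.

Let dual_comul_linear : linear dual_comul.
Proof.
by move=> a f g; apply: tev_inj => x y; rewrite tev_linear !tev_comul.
Qed.

Let dual_comul_mm : monoid_morphism dual_comul.
Proof.
split=> [|f g]; apply: tev_inj => x y; rewrite tev_comul.
  by rewrite tens1 tevE !dual_oneE counitM.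
rewrite tevM dual_mulE -/(conv f g _) convM; try exact: hopf_dual_scalar.
by apply: eq_bigr => p _; apply: eq_bigr => q _; rewrite !tev_comul.
Qed.

Let dual_counit_scalar : scalar dual_counit.
Proof. by move=> a f g; apply: hopf_dual_lin. Qed.

Let dual_counit_mm : monoid_morphism dual_counit.
Proof.
split=> [|f g]; first by rewrite /dual_counit dual_oneE counit1.
apply: (sw1 (U := K^o) (beta := fun x y => f x * g y)).
by apply: mul_biscalar; apply: hopf_dual_scalar.
Qed.

Let dual_antipode_linear : linear dual_antipode.
Proof. by move=> a f g; apply: hopf_dual_ext. Qed.

Let dual_comulA f :
  tassoc (tmap dual_comul id (dual_comul f)) = tmap id dual_comul (dual_comul f).
Proof.
apply: tev3_inj => x y z.
have lin3 := tev3_linear x y z.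
transitivity (f (x * y * z)); last first.
  rewrite -mulrA -tev_comul /tmap /tev /tlift [RHS](lin_sum (W := K^o) _ _ lin3).
  by apply: eq_bigr => p _; rewrite tev3E tev_comul.
rewrite -(tev_comul f) /tmap [tlift _ (dual_comul f)]/tlift /tassoc.
rewrite (lin_sum _ _ (tlift_linear (@tassoc_bil _ _ _ _))).
rewrite [LHS](lin_sum _ _ lin3); apply: eq_bigr => p _.
rewrite -/(tassoc _) -[in RHS]tev_comul.
move: (dual_comul p.1) (p.2) => t h.
have lin_t : linear (fun t => tev3 (tassoc (t ⊗ h)) x y z).
  move=> a u v; rewrite (bilDl (tens_bilinear _ _)) (bilZl (tens_bilinear _ _)).
  by rewrite /tassoc (tlift_linear (@tassoc_bil _ _ _ _)) tev3_linear.
have lin_t' : linear (fun t => tev t x y * h z : K^o).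
  by move=> a u v; rewrite tev_linear mulrDl -mulrA.
apply: (tensor_ext lin_t lin_t') => f' g' /=.
by rewrite tassocE tev3E !tevE mulrA.
Qed.

Let dual_counitl f :
  tlift (fun g h => dual_counit g *: h) (dual_comul f) = f.
Proof.
apply: hopf_dual_ext => y; rewrite -[in RHS](mul1r y) -tev_comul /tlift /tev.
have l : linear (fun f : D => f y : K^o) by move=> a g h; apply: hopf_dual_lin.
by rewrite [LHS](lin_sum _ _ l); apply: eq_bigr.
Qed.

Let dual_counitr f :
  tlift (fun g h => dual_counit h *: g) (dual_comul f) = f.
Proof.
apply: hopf_dual_ext => y; rewrite -[in RHS](mulr1 y) -tev_comul /tlift /tev.
have l : linear (fun f : D => f y : K^o) by move=> a g h; apply: hopf_dual_lin.
by rewrite [LHS](lin_sum _ _ l); apply: eq_bigr => p _; apply: mulrC.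
Qed.

Let dual_antipodel f :
  tlift (fun g h => dual_antipode g * h) (dual_comul f) = (dual_counit f)%:A.
Proof.
apply: hopf_dual_ext => x; rewrite -[RHS]/(f 1 * eps x) /tlift.
have l : linear (fun f : D => f x : K^o) by move=> a g h; apply: hopf_dual_lin.
rewrite [LHS](lin_sum _ _ l) mulrC -(functionalZ _ _ (hopf_dual_scalar f)).
rewrite -sw_antipodel (functional_sum _ _ (hopf_dual_scalar f)).
transitivity (\sum_(p <- trepr (dual_comul f)) \sum_(q <- sw x)
    p.1 (S q.1) * p.2 q.2); first by [].
by rewrite exchange_big; apply: eq_bigr => q _; rewrite -tev_comul.
Qed.

Let dual_antipoder f :
  tlift (fun g h => g * dual_antipode h) (dual_comul f) = (dual_counit f)%:A.
Proof.
apply: hopf_dual_ext => x; rewrite -[RHS]/(f 1 * eps x) /tlift.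
have l : linear (fun f : D => f x : K^o) by move=> a g h; apply: hopf_dual_lin.
rewrite [LHS](lin_sum _ _ l) mulrC -(functionalZ _ _ (hopf_dual_scalar f)).
rewrite -sw_antipoder (functional_sum _ _ (hopf_dual_scalar f)).
transitivity (\sum_(p <- trepr (dual_comul f)) \sum_(q <- sw x)
    p.1 q.1 * p.2 (S q.2)); first by [].
by rewrite exchange_big; apply: eq_bigr => q _; rewrite -tev_comul.
Qed.

HB.instance Definition _ := Algebra_isHopf.Build K D
  dual_comul_linear dual_comul_mm dual_counit_scalar dual_counit_mm
  dual_antipode_linear dual_comulA dual_counitl dual_counitr
  dual_antipodel dual_antipoder.

Lemma comul_dualE f x y : tev (comul f) x y = f (x * y).
Proof. exact: tev_comul. Qed.

Lemma counit_dualE f : counit f = f 1.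
Proof. by []. Qed.

Lemma antipode_dualE f x : antipode f x = f (S x).
Proof. by []. Qed.

End HopfDualStructure.

Section HopfNotions.
Variables (K : fieldType) (H : hopfAlgType K).
Implicit Types I J L M : set H.

(* The image of P ⊗ Q in V ⊗ W *)
Definition tens_sub (V W : lmodType K) (P : set V) (Q : set W) :
    set (tensor V W) :=
  fun t => exists s : seq (V * W),
    (forall p, p \in s -> P p.1 /\ Q p.2) /\ t = \sum_(p <- s) p.1 ⊗ p.2.

Definition hopf_ideal I :=
  [/\ two_sided_ideal I,
      forall x, I x -> exists t u, [/\ tens_sub I setT t, tens_sub setT I u
        & comul x = t + u],
      forall x, I x -> counit x = 0
    & forall x, I x -> I (antipode x)].

Definition hopf_subalgebra L :=
  [/\ is_subspace L,
      L 1,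
      forall x y, L x -> L y -> L (x * y),
      forall x, L x -> tens_sub L L (comul x)
    & forall x, L x -> L (antipode x)].

Definition hopf_finitely_generated L := exists s : seq H,
  (forall x, x \in s -> L x) /\
  forall M, hopf_subalgebra M -> (M `<=` L)%classic ->
    (forall x, x \in s -> M x) -> M = L.

Definition inner_linear := exists I,
  [/\ two_sided_ideal I, finite_codim I
    & forall J, hopf_ideal J -> (J `<=` I)%classic -> J = [set 0]%classic].

Definition separates_points (L : set (hopf_dual H)) :=
  forall x, x != 0 -> exists2 f, L f & f x != 0.

End HopfNotions.

(* Main.v *)
Require Import Defs.
From mathcomp Require Import all_boot all_order all_algebra.
From mathcomp Require Import reals complex.
From mathcomp Require Import boolp classical_sets.

(** The theorem is an instance of the duality between ideals of [H] and
    subspaces of functionals, which exchanges Hopf ideals and Hopf subalgebras: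
    the common zeros of a Hopf subalgebra of the dual form a Hopf ideal
    ([null_space_hopf_ideal]), and the elements of a Hopf subalgebra that vanish
    on a Hopf ideal form a Hopf subalgebra ([hopf_subalgebraI_annihilator]).

    Let [I] be a two-sided ideal of finite codimension without nonzero Hopf
    ideal inside.  The functionals that vanish on [I] form a finite-dimensional
    subcoalgebra of the dual, namely the dual of the finite-dimensional algebra
    [H / I]; hence the subalgebra [L] generated by its images under the powers
    of the antipode is a finitely generated Hopf subalgebra.  The common zeros
    of [L] form a Hopf ideal, contained in [I] because functionals separate the
    points of [H / I].  So they reduce to [0], which is to say that [L]
    separates the points of [H].

    Conversely, let [L] be generated by a finite set [s] and separate points.
    The elements of [s] all vanish on some ideal [I] of finite codimension.  If
    [J] is a Hopf ideal inside [I], the elements of [L] that vanish on [J] form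
    a Hopf subalgebra containing [s], so they exhaust [L]: every element of [L]
    vanishes on [J], and [J] is zero.

    Both halves of the duality need to locate a tensor from the way functionals
    act on it: the zeros of [L ⊗ L] in [H ⊗ H] lie in the sum of [J ⊗ H] and
    [H ⊗ J] for [J] the zeros of [L], and the part of [L ⊗ L] that vanishes when
    either argument is in [J] is the tensor square of the part of [L] vanishing
    on [J].  Both are cases of [tens_kernel_split]. *)

Set Implicit Arguments.
Unset Strict Implicit.
Unset Printing Implicit Defensive.

Import GRing.Theory.

Local Open Scope ring_scope.
Local Open Scope complex_scope.
Local Open Scope classical_set_scope.

(** * Tensors annihilated by functionals *)

Section LinearAlgebra.
Variable K : fieldType.

Lemma subspace_sum (V : lmodType K) (P : set V) (I : eqType) (r : seq I)
    (F : I -> V) :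
  is_subspace P -> (forall i, i \in r -> P (F i)) -> P (\sum_(i <- r) F i).
Proof.
move=> Ps PF; rewrite big_seq; apply: (big_ind P) => // [|x y].
  exact: Ps.1.
exact: subspaceD.
Qed.

Lemma subspaceT (V : lmodType K) : is_subspace [set: V].
Proof. by []. Qed.

Lemma subspace0 (V : lmodType K) : is_subspace [set (0 : V)].
Proof. by split=> // a x y -> ->; rewrite scaler0 addr0. Qed.

Lemma functional_kernel_subspace (V : lmodType K) (X : Type) (A : set X)
    (i : X -> V -> K) :
  (forall x, scalar (i x)) ->
  is_subspace (fun v => forall x, A x -> i x v = 0).
Proof.
move=> li; split=> [x _|a v w v0 w0 x Ax]; first exact: functional0.
by rewrite li v0 // w0 // mulr0 addr0.
Qed.

(** Exactness of the tensor product over a field, in elementary form.  By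
    induction on the number of terms: when the right factor of the first term
    lies modulo [Q'] in the span of the others, the term is absorbed by the
    others, up to a term of [P ⊗ Q'].  When it does not, the contractions force
    its left factor into the common kernel of the [i x].  Taking an arbitrary bilinear [beta] in
    place of the tensor product makes the statement usable on both sides. *)
Lemma tens_kernel_split (V W U : lmodType K) (beta : V -> W -> U)
    (X : Type) (A : set X) (i : X -> V -> K) (P : set V) (Q Q' : set W)
    (s : seq (V * W)) :
  is_bilinear beta -> (forall x, scalar (i x)) ->
  is_subspace P -> is_subspace Q -> is_subspace Q' ->
  (forall p, p \in s -> P p.1 /\ Q p.2) ->
  (forall x, A x -> Q' (\sum_(p <- s) i x p.1 *: p.2)) ->
  exists u v : seq (V * W),
    [/\ forall p, p \in u -> (P p.1 /\ forall x, A x -> i x p.1 = 0) /\ Q p.2,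
        forall p, p \in v -> P p.1 /\ (Q p.2 /\ Q' p.2)
      & \sum_(p <- s) beta p.1 p.2 =
        \sum_(p <- u) beta p.1 p.2 + \sum_(p <- v) beta p.1 p.2].
Proof.
move=> bP li Ps Qs Q's.
have [n] := ubnP (size s).
elim: n s => // n IH [|p s] /= szs PQ E.
  by exists [::], [::]; split=> //; rewrite !big_nil addr0.
have [Pp Qp] := PQ p (mem_head _ _).
have PQs q : q \in s -> P q.1 /\ Q q.2.
  by move=> qs; apply: PQ; rewrite inE qs orbT.
have [[c [r [Qr Q'r pE]]]|np] := pselect (exists c : V * W -> K, exists r,
    [/\ Q r, Q' r & p.2 = \sum_(q <- s) c q *: q.2 + r]).
  (* p.1 ⊗ p.2 is redistributed over the other terms along the expansion of
     p.2, which leaves the remainder p.1 ⊗ r. *)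
  pose s' := [seq (q.1 + c q *: p.1, q.2) | q <- s].
  have [|_ /mapP[q qs ->]|x Ax|u [v [Hu Hv e]]] := IH s'.
  - by rewrite size_map.
  - have [Pq Qq] := PQs q qs; split=> //=.
    by apply: subspaceD => //; apply: subspaceZ.
  - have := subspaceB Q's (E x Ax) (subspaceZ (i x p.1) Q's Q'r).
    rewrite big_cons pE scalerDr addrAC addrK big_map scaler_sumr -big_split /=.
    congr Q'; apply: eq_bigr => q _.
    rewrite [q.1 + _]addrC li scalerDl scalerA; congr (_ *: _ + _).
    exact: mulrC.
  exists u, ((p.1, r) :: v); split=> //.
    by move=> q; rewrite inE => /orP[/eqP->|/Hv].
  rewrite !big_cons /= addrCA -e pE (bilDr bP) (bil_sumr bP) big_map.
  rewrite [LHS]addrAC addrC -big_split; congr (_ + _); apply: eq_bigr => q _.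
  by rewrite /= (bilDl bP) (bilZl bP) (bilZr bP) addrC.
have ip x : A x -> i x p.1 = 0.
  move=> Ax; apply/eqP/negPn/negP => ip; apply: np.
  set t := \sum_(q <- p :: s) i x q.1 *: q.2.
  have := E x Ax; rewrite -/t => Q't.
  (* Solving the contraction t for p.2 puts p.2 in the excluded span. *)
  exists (fun q => - (i x p.1)^-1 * i x q.1), ((i x p.1)^-1 *: t).
  split; last 1 first.
  - rewrite /t big_cons scalerDr scalerA mulVf // scale1r addrCA.
    rewrite scaler_sumr -big_split big1 ?addr0 //= => q _.
    by rewrite mulNr scaleNr scalerA addNr.
  - apply: subspaceZ => //; apply: subspace_sum => // q qs.
    by apply: subspaceZ => //; have [] := PQ q qs.
  - exact: subspaceZ.
have [x Ax|u [v [Hu Hv e]]] := IH s szs PQs.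
  by have := E x Ax; rewrite big_cons ip // scale0r add0r.
exists (p :: u), v; split=> //.
  by move=> q; rewrite inE => /orP[/eqP->|/Hu].
by rewrite !big_cons e addrA.
Qed.

Lemma finite_codimI (V : lmodType K) (P Q : set V) :
  is_subspace P -> is_subspace Q -> finite_codim P -> finite_codim Q ->
  finite_codim (P `&` Q).
Proof.
move=> Ps Qs /(finite_codim_coord Ps)[s [ls _ sP]].
move=> /(finite_codim_coord Qs)[t [lt _ tQ]].
apply: (finite_codim_ker (s := [seq p.1 | p <- s ++ t])) =>
  [_ /mapP[p + ->]|x x0].
  by rewrite mem_cat => /orP[/ls|/lt].
have x0' p : p \in s ++ t -> p.1 x = 0 by move=> pst; apply/x0/map_f.
split.
  have := sP x; rewrite big_seq big1 ?subr0 // => p ps.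
  by rewrite x0' ?scale0r // mem_cat ps.
have := tQ x; rewrite big_seq big1 ?subr0 // => p pt.
by rewrite x0' ?scale0r // mem_cat pt orbT.
Qed.

Lemma tens_sub_lin (V W : lmodType K) (P : set V) (Q : set W) (a : K) t u :
  is_subspace P -> tens_sub P Q t -> tens_sub P Q u -> tens_sub P Q (a *: t + u).
Proof.
move=> Ps [s [Hs ->]] [r [Hr ->]].
exists ([seq (a *: p.1, p.2) | p <- s] ++ r); split=> [p|].
  rewrite mem_cat => /orP[/mapP[q /Hs[Pq Qq] ->]|/Hr//]; split=> //=.
  exact: subspaceZ.
rewrite big_cat big_map scaler_sumr; congr (_ + _); apply: eq_bigr => p _ /=.
by rewrite (bilZl (tens_bilinear _ _)).
Qed.

Lemma tens_subM (A B : algType K) (P : set A) (Q : set B) t u :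
  (forall x y, P x -> P y -> P (x * y)) ->
  (forall x y, Q x -> Q y -> Q (x * y)) ->
  tens_sub P Q t -> tens_sub P Q u -> tens_sub P Q (t * u).
Proof.
move=> PM QM [s [Hs ->]] [r [Hr ->]].
exists [seq (p.1 * q.1, p.2 * q.2) | p <- s, q <- r]; split=> [z|].
  move=> /allpairsP[[p q] /= [/Hs[? ?] /Hr[? ?] ->]] /=.
  by split; [apply: PM|apply: QM].
rewrite big_allpairs_dep mulr_suml; apply: eq_bigr => p _.
by rewrite mulr_sumr; apply: eq_bigr => q _; rewrite tensM.
Qed.

Lemma tens_subS (V W : lmodType K) (P P' : set V) (Q Q' : set W) :
  P `<=` P' -> Q `<=` Q' -> tens_sub P Q `<=` tens_sub P' Q'.
Proof.
by move=> PP QQ t [s [Hs ->]]; exists s; split=> // p /Hs[/PP ? /QQ].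
Qed.

End LinearAlgebra.

(** * The duality between Hopf ideals and Hopf subalgebras *)

Section Duality.
Variables (K : fieldType) (H : hopfAlgType K).
Local Notation D := (hopf_dual H).
Implicit Types (L M : set D) (I J : set H) (f g : D) (x y : H).

Definition null_space L : set H := fun x => forall f, L f -> f x = 0.

Definition annihilator J : set D := fun f => forall x, J x -> f x = 0.

Lemma hopf_dual_sum (T : Type) (r : seq T) (F : T -> D) x :
  (\sum_(i <- r) F i) x = \sum_(i <- r) F i x :> K.
Proof.
have l : linear (fun f : D => f x : K^o) by move=> a g h; apply: hopf_dual_lin.
exact: (lin_sum _ _ l).
Qed.

Lemma tev_sum (s : seq (D * D)) x y :
  tev (\sum_(p <- s) p.1 ⊗ p.2) x y = \sum_(p <- s) p.1 x * p.2 y.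
Proof. by rewrite /tev tlift_sum //; exact: ev_bil. Qed.

Lemma comul_dual_eq f (s : seq (D * D)) :
  (forall x y, f (x * y) = \sum_(p <- s) p.1 x * p.2 y) ->
  comul f = \sum_(p <- s) p.1 ⊗ p.2.
Proof. by move=> fs; apply: tev_inj => x y; rewrite comul_dualE tev_sum. Qed.

Lemma hopf_subalgebra_split L f : hopf_subalgebra L -> L f ->
  exists s : seq (D * D), (forall p, p \in s -> L p.1 /\ L p.2) /\
    forall x y, f (x * y) = \sum_(p <- s) p.1 x * p.2 y.
Proof.
move=> [_ _ _ Lc _] /Lc[s [Ls e]]; exists s; split=> // x y.
by rewrite -comul_dualE e tev_sum.
Qed.

(** Each closure property of [L] dualizes.  Stability under the comultiplication
    makes the zeros an ideal, and the unit and the antipode of [L] give the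
    counit and antipode conditions.  For the coideal condition, [(f * g) x = 0]
    says that [f ⊗ g] kills [comul x] for all [f] and [g] in [L]; then
    contracting with [f] gives a zero of [L], and [tens_kernel_split] applies. *)
Lemma null_space_hopf_ideal L :
  hopf_subalgebra L -> hopf_ideal (null_space L).
Proof.
move=> Lh; have [Ls L1 LM _ LS] := Lh.
set J := null_space L.
have Jl x y : J x -> J (x * y).
  move=> Jx f /(hopf_subalgebra_split Lh)[s [sL ->]].
  by rewrite big_seq big1 // => p /sL[/Jx-> _]; rewrite mul0r.
have Jr x y : J y -> J (x * y).
  move=> Jy f /(hopf_subalgebra_split Lh)[s [sL ->]].
  by rewrite big_seq big1 // => p /sL[_ /Jy->]; rewrite mulr0.
have Js : is_subspace J.
  exact: (functional_kernel_subspace L (@hopf_dual_scalar K H)).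
split=> [|x Jx|x Jx|x Jx].
- by split=> // a x b Jx; apply/Jl/Jr.
- have [g Lg f Lf|u [v [Hu Hv e]]] := tens_kernel_split (A := L)
    (i := fun f => f) (Q' := J) (s := trepr (comul x)) (tens_bilinear H H)
    (@hopf_dual_scalar K H) (subspaceT H) (subspaceT H) Js (fun _ _ => conj I I).
    rewrite (functional_sum _ _ (hopf_dual_scalar f)).
    rewrite -[RHS](Jx _ (LM _ _ Lg Lf)) dual_mulE; apply: eq_bigr => p _.
    exact: (functionalZ _ _ (hopf_dual_scalar f)).
  exists (\sum_(p <- u) p.1 ⊗ p.2), (\sum_(p <- v) p.1 ⊗ p.2); split.
  + by exists u; split=> // p /Hu[[_ ?] _].
  + by exists v; split=> // p /Hv[_ [_ ?]].
  + by rewrite -e -tensorE.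
- by rewrite -(dual_oneE x); apply: Jx.
- by move=> f Lf; rewrite -antipode_dualE; apply/Jx/LS.
Qed.

Lemma conv_coideal0 J f g x : hopf_ideal J -> J x ->
  annihilator J f -> annihilator J g -> (f * g) x = 0.
Proof.
move=> [_ Jc _ _] Jx f0 g0.
have b := mul_biscalar (hopf_dual_scalar f) (hopf_dual_scalar g).
rewrite dual_mulE -/(tlift (fun y z => f y * g z : K^o) (comul x)).
have [_ [_ [[s [Hs ->]] [t [Ht ->]] ->]]] := Jc x Jx.
rewrite -big_cat (tlift_sum b) big_cat !big_seq /= !big1 ?addr0 // => p.
  by move=> /Ht[_ /g0->]; rewrite mulr0.
by move=> /Hs[/f0-> _]; rewrite mul0r.
Qed.

(** Since [J] is an ideal, the tensor [comul f] of [L ⊗ L], seen as the function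
    sending [(x, y)] to [f (x * y)], vanishes as soon as [x] or [y] is in [J].
    Two applications of [tens_kernel_split] with [Q' = 0] then move the left
    factors and next the right factors into the annihilator of [J]. *)
Lemma hopf_subalgebraI_annihilator L J : hopf_subalgebra L -> hopf_ideal J ->
  hopf_subalgebra (L `&` annihilator J).
Proof.
move=> [Ls L1 LM Lc LS] Jh; have [[Js Jm] Jc Je JS] := Jh.
have ev_scalar x : scalar (fun f : D => f x).
  by move=> a f g; apply: hopf_dual_lin.
set M := L `&` annihilator J.
have Ms : is_subspace M.
  have [N0 Nl] := functional_kernel_subspace J ev_scalar.
  split=> [|a f g [Lf f0] [Lg g0]]; first by split; [exact: Ls.1 | exact: N0].
  by split; [exact: Ls.2 | exact: Nl].
split=> [||f g [Lf f0] [Lg g0]|f [Lf f0]|f [Lf f0]].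
- exact: Ms.
- by split=> // x /Je.
- by split=> [|x Jx]; [exact: LM | exact: conv_coideal0 Jh Jx f0 g0].
- have [s [sL fE]] := Lc f Lf.
  have fs x y : f (x * y) = \sum_(p <- s) p.1 x * p.2 y.
    by rewrite -comul_dualE fE tev_sum.
  have Jl x y : J x -> J (x * y).
    by move=> Jx; have := Jm 1 x y Jx; rewrite mul1r.
  have Jr x y : J y -> J (x * y).
    by move=> Jy; have := Jm x y 1 Jy; rewrite mulr1.
  have [x Jx|u [v [Hu Hv e]]] := tens_kernel_split (A := J) (tens_bilinear D D)
      ev_scalar Ls Ls (subspace0 D) sL.
    apply: hopf_dual_ext => y; rewrite hopf_dual_sum.
    by rewrite -[RHS](f0 _ (Jl x y Jx)) fs; apply: eq_bigr.
  (* The terms of v have a zero right factor. *)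
  have {}fE : comul f = \sum_(p <- u) p.1 ⊗ p.2.
    rewrite fE e [X in _ + X]big1_seq ?addr0 // => p /andP[_ /Hv[_ [_ ->]]].
    exact: bil0r (tens_bilinear _ _) _.
  have {}fs x y : f (x * y) = \sum_(p <- u) p.1 x * p.2 y.
    by rewrite -comul_dualE fE tev_sum.
  (* The other side, with the factors exchanged; the left factors already found
     are kept in M. *)
  pose u' := [seq (p.2, p.1) | p <- u].
  have [_ /mapP[p /Hu pu ->]|x Jx|w [v' [Hw Hv' e']]] := tens_kernel_split
      (s := u') (A := J) (bil_flip (tens_bilinear D D)) ev_scalar Ls Ms
      (subspace0 D).
  + by case: pu.
  + apply: hopf_dual_ext => y; rewrite hopf_dual_sum.
    rewrite -[RHS](f0 _ (Jr y x Jx)) fs big_map; apply: eq_bigr => p _.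
    exact: mulrC.
  exists [seq (p.2, p.1) | p <- w]; split=> [_ /mapP[p /Hw[? ?] ->]//|].
  rewrite big_map fE -[LHS](big_map (fun p => (p.2, p.1)) predT
    (fun p => p.2 ⊗ p.1)) -/u' e' [X in _ + X]big1_seq ?addr0 //.
  by move=> p /andP[_ /Hv'[_ [_ ->]]]; exact: bil0l (tens_bilinear _ _) _.
- by split=> [|x /JS/f0//]; exact: LS.
Qed.

(** * Generated Hopf subalgebras of the dual *)

(** Closure under the algebra operations and the antipode alone: closure under
    the comultiplication is left to be proved, for [C] a subcoalgebra. *)
Inductive generated (C : set D) : set D :=
| generated_in f : C f -> generated C f
| generated0 : generated C 0
| generated_lin a f g :
    generated C f -> generated C g -> generated C (a *: f + g)
| generated1 : generated C 1
| generatedM f g : generated C f -> generated C g -> generated C (f * g)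
| generatedS f : generated C f -> generated C (antipode f).

Lemma generated_min (C : set D) M :
  hopf_subalgebra M -> C `<=` M -> generated C `<=` M.
Proof.
move=> [[M0 Ml] M1 MM _ MS] CM f; elim=> {f} //.
- by move=> a f g _ Mf _ Mg; apply: Ml.
- by move=> f g _ Mf _ Mg; apply: MM.
- by move=> f _; apply: MS.
Qed.

(** The antipode of the dual reverses the comultiplication, because it is
    composition with the antipode of [H], which reverses products. *)
Lemma comul_antipode_dual (P Q : set D) f : tens_sub P Q (comul f) ->
  tens_sub (@antipode K D @` Q) (@antipode K D @` P) (comul (antipode f)).
Proof.
move=> [s [Hs fE]].
exists [seq (antipode p.2, antipode p.1) | p <- s].
split=> [_ /mapP[p /Hs[? ?] ->]|].
  by split; [exists p.2 | exists p.1].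
apply: comul_dual_eq => x y.
rewrite antipode_dualE antipodeM -comul_dualE fE tev_sum.
by rewrite big_map; apply: eq_bigr => p _; rewrite /= mulrC.
Qed.

(** The comultiplication is an algebra morphism that the antipode reverses, so
    it is enough to check its values on the generators. *)
Lemma generated_hopf_subalgebra (C : set D) :
  (forall f, C f -> tens_sub C C (comul f)) -> hopf_subalgebra (generated C).
Proof.
move=> Cc.
have Gs : is_subspace (generated C).
  by split; [exact: generated0 | exact: generated_lin].
split=> // [||f|f]; [exact: generated1|exact: generatedM| |exact: generatedS].
elim=> {f} [f /Cc|||||].
- by apply: tens_subS; exact: generated_in.
- by exists [::]; split=> //; apply: comul_dual_eq => x y; rewrite big_nil.
- by move=> a f g _ fc _ gc; rewrite comul_linear; apply: tens_sub_lin.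
- exists [:: (1, 1)]; split=> [p|]; last first.
    by rewrite big_seq1 comul_monoid_morphism.1 tens1.
  by rewrite inE => /eqP->; split; exact: generated1.
- move=> f g _ fc _ gc; rewrite comul_monoid_morphism.2.
  by apply: tens_subM => // *; exact: generatedM.
- move=> f _ /comul_antipode_dual; apply: tens_subS => _ [g Gg <-];
    exact: generatedS.
Qed.

(** * The annihilator of an ideal of finite codimension *)

Section IdealAnnihilator.
Variable I : set H.
Hypotheses (Ii : two_sided_ideal I) (Ic : finite_codim I).

Lemma annihilator_in_dual (f : H -> K) :
  scalar f -> (forall x, I x -> f x = 0) -> in_hopf_dual f.
Proof. by move=> lf f0; split=> //; exists I. Qed.

(** Dual bases of [H / I], with the coordinate functionals lifted to elements of
    the Hopf dual of [H]; that they separate the points of [H / I] is what makes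
    the zeros of the generated Hopf subalgebra fall inside [I]. *)
Lemma annihilator_basis : exists s : seq (D * H),
  [/\ forall p, p \in s -> annihilator I p.1,
      forall x, (forall p, p \in s -> p.1 x = 0) -> I x
    & forall x, I (x - \sum_(p <- s) (p.1 x : K) *: p.2)].
Proof.
have [s [ls s0 sP]] := finite_codim_coord Ii.1 Ic.
have [t [tC tE]] : exists t : seq (D * H),
    (forall p, p \in t -> annihilator I p.1) /\
    s = [seq (hopf_dual_fun p.1 : H -> K, p.2) | p <- t].
  elim: s ls s0 {sP} => [|[f z] s IH] ls s0; first by exists [::].
  have [p ps|p x ps|t [tC ->]] := IH.
  - by apply: ls; rewrite inE ps orbT.
  - by apply: s0; rewrite inE ps orbT.
  have f0 := s0 _ _ (mem_head _ _).
  exists ((mk_hopf_dual (annihilator_in_dual (ls _ (mem_head _ _)) f0), z) :: t).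
  by split=> // p; rewrite inE => /orP[/eqP->|/tC].
have {}sP x : I (x - \sum_(p <- t) (p.1 x : K) *: p.2).
  by have := sP x; rewrite tE big_map.
exists t; split=> // x x0.
by have := sP x; rewrite big_seq big1 ?subr0 // => p /x0->; rewrite scale0r.
Qed.

Lemma annihilator_span (s : seq (D * H)) f :
  (forall x, I (x - \sum_(p <- s) (p.1 x : K) *: p.2)) -> annihilator I f ->
  forall x, f x = \sum_(p <- s) p.1 x * f p.2.
Proof.
move=> sP f0 x; have lf := hopf_dual_scalar f.
have := f0 _ (sP x).
rewrite -scaleN1r addrC lf mulN1r addrC => /eqP; rewrite subr_eq0 => /eqP->.
rewrite (functional_sum _ _ lf); apply: eq_bigr => p _.
exact: (functionalZ _ _ lf).
Qed.

(** The annihilator is the dual of the algebra [H / I], hence a subcoalgebra: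
    expanding [x] in coordinates of [H / I] writes [f (x * y)] as the sum of the
    [p.1 x * f (p.2 * y)], and all the factors vanish on [I]. *)
Lemma annihilator_comul f :
  annihilator I f -> tens_sub (annihilator I) (annihilator I) (comul f).
Proof.
move=> f0; have [s [sC _ sP]] := annihilator_basis.
have lf := hopf_dual_scalar f.
have tr0 z y : I y -> f (z * y) = 0.
  by move=> Iy; apply: f0; have := Ii.2 z y 1 Iy; rewrite mulr1.
have trl z : scalar (fun y => f (z * y)).
  by move=> a x y; rewrite mulrDr -scalerAr lf.
pose tr z := mk_hopf_dual (annihilator_in_dual (trl z) (tr0 z)).
exists [seq (p.1, tr p.2) | p <- s]; split=> [_ /mapP[p /sC ps ->]|].
  by split=> // y; exact: tr0.
apply: comul_dual_eq => x y; rewrite big_map.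
have := f0 _ (Ii.2 1 _ y (sP x)); rewrite mul1r mulrBl -scaleN1r addrC lf mulN1r.
rewrite addrC => /eqP; rewrite subr_eq0 => /eqP->.
rewrite mulr_suml (functional_sum _ _ lf); apply: eq_bigr => p _.
by rewrite -scalerAl (functionalZ _ _ lf).
Qed.

(** The coordinates of [H / I] span the annihilator, so they generate the same
    Hopf subalgebra. *)
Lemma generated_annihilator_finitely_generated :
  hopf_finitely_generated (generated (annihilator I)).
Proof.
have [s [sC _ sP]] := annihilator_basis.
exists [seq p.1 | p <- s]; split=> [_ /mapP[p /sC ps ->]|M Mh ML sM].
  exact: generated_in.
apply/seteqP; split=> //; apply: generated_min => // f f0.
suff -> : f = \sum_(p <- s) (f p.2 : K) *: p.1.
  have [Ms _ _ _ _] := Mh; apply: subspace_sum => // p ps.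
  by apply: subspaceZ => //; apply/sM/map_f.
apply: hopf_dual_ext => x; rewrite hopf_dual_sum (annihilator_span sP f0).
by apply: eq_bigr => p _; exact: mulrC.
Qed.

End IdealAnnihilator.

(** * Inner linearity *)

Lemma common_ideal_in_kernels (s : seq D) : exists I,
  [/\ two_sided_ideal I, finite_codim I
    & forall f, f \in s -> annihilator I f].
Proof.
elim: s => [|f s [I [Ii Ic Is]]].
  by exists setT; split=> //; exists 0%N, (fun=> 0) => x; exists (fun=> 0).
have [_ [J [Ji Jc Jf]]] := hopf_dualP f.
exists (I `&` J); split; last first.
- move=> g; rewrite inE => /orP[/eqP->|/Is g0] x [? ?].
    exact: Jf.
  exact: g0.
- exact: (finite_codimI Ii.1 Ji.1).
- split=> [|a x b [Ix Jx]]; last by split; [exact: Ii.2 | exact: Ji.2].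
  split=> [|a x y [Ix Jx] [Iy Jy]].
    by split; [exact: Ii.1.1 | exact: Ji.1.1].
  by split; [exact: Ii.1.2 | exact: Ji.1.2].
Qed.

Theorem inner_linear_iff_dual_separates :
  inner_linear H <->
  exists L : set D,
    [/\ hopf_subalgebra L, hopf_finitely_generated L & separates_points L].
Proof.
split=> [[I [Ii Ic Imax]]|[L [Lh [s [sL sgen]] Lsep]]].
  exists (generated (annihilator I)).
  have Lh := generated_hopf_subalgebra (annihilator_comul Ii Ic).
  split=> //; first exact: generated_annihilator_finitely_generated.
  have [t [tC tI _]] := annihilator_basis Ii Ic.
  have L0 : null_space (generated (annihilator I)) = [set 0].
    apply: Imax; first exact: null_space_hopf_ideal.
    by move=> x Lx; apply: tI => p /tC pI; apply/Lx/generated_in.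
  move=> x /eqP x0; apply: contrapT => nf; apply: x0.
  rewrite -[_ = _]/([set 0] x) -L0 => f Lf.
  by apply/eqP/negPn/negP => fx; apply: nf; exists f.
have [I [Ii Ic Is]] := common_ideal_in_kernels s.
exists I; split=> // J Jh JI.
have ML : L `&` annihilator J = L.
  apply: sgen => [|f []//|f fs]; first exact: hopf_subalgebraI_annihilator.
  by split=> [|x /JI]; [exact: sL | exact: Is].
have [[[J0 _] _] _ _ _] := Jh.
apply/seteqP; split=> [x Jx|_ ->//].
apply/eqP/negPn/negP => /Lsep[f]; rewrite -ML => -[_ /(_ x Jx)->].
by rewrite eqxx.
Qed.

End Duality.

Theorem theorem2p1 (R : realType) (H : hopfAlgType R[i]) :
  inner_linear H <->
  exists L : hopf_dual H -> Prop,
    [/\ hopf_subalgebra L, hopf_finitely_generated L & separates_points L].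
Proof. exact: inner_linear_iff_dual_separates. Qed.
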